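(* Let $L,R:[0,\infty)\times\mathbb{R}\to\mathbb{R}$ satisfy: (i) for each $x\in\mathbb{R}$, $L(\cdot,x),R(\cdot,x)\in D[0,\infty)$; (ii) for each $t\ge 0$, $L(t,\cdot)$ and $R(t,\cdot)$ are strictly increasing; (iii) there are constants $0<c<C<\infty$ such that $c|x-y|\le |L(t,x)-L(t,y)|\le C|x-y|$ and $c|x-y|\le |R(t,x)-R(t,y)|\le C|x-y|$ for all $t\ge 0$, $x,y\in\mathbb{R}$; (iv) $\inf_{(t,x)\in[0,\infty)\times\mathbb{R}}(R(t,x)-L(t,x))>0$. Let $c^1_0,c^2_0\in\mathbb{R}$ and $S^1,S^2\in D[0,\infty)$ with $S^1_0=S^2_0=0$, and suppose there is $\nu\in I[0,\infty)$ such that $S^1=S^2+\nu$. For $i=1,2$, let $(X^i,K^i)$ be the solution of $\mathbb{SP}_L^R(c_0^i+S^i)$, with decomposition $K^i=K^{i,r}-K^{i,l}$ as in the definition of a solution. Then for all $t\ge0$: 1. $K_t^{1,r}-(c^2_0-c^1_0)^+\le K^{2,r}_t\le K^{1,r}_t+\nu_t+(c_0^1-c_0^2)^+$; 2. $K_t^{2,l}-(c^2_0-c^1_0)^+\le K^{1,l}_t\le K^{2,l}_t+\nu_t+(c_0^1-c_0^2)^+$.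
   Context: $D[0,\infty)$ is the set of real-valued right-continuous functions on $[0,\infty)$ with left limits; $I[0,\infty)$ is the subset of nondecreasing functions; $BV[0,\infty)$ is the set of $K\in D[0,\infty)$ of bounded variation on each compact interval. Notation: $a^+=\max(a,0)$. Skorokhod problem $\mathbb{SP}_L^R(S)$: a pair $(X,K)\in D[0,\infty)\times BV[0,\infty)$ is a solution if (a) $X_t=S_t+K_t$ for all $t\ge0$; (b) $L(t,X_t)\le 0\le R(t,X_t)$ for all $t\ge 0$; (c) $K_{0-}=0$ and $K=K^r-K^l$, where $K^r,K^l$ are nondecreasing (right-continuous, with $K^r_{0-}=K^l_{0-}=0$) and $\int_0^\infty I_{\{L(s,X_s)<0\}}dK^l_s=0$, $\int_0^\infty I_{\{R(s,X_s)>0\}}dK^r_s=0$. The integrals are over $[0,\infty)$ including time $0$, where $dK^r,dK^l$ have atoms of mass $K^r_0,K^l_0$. Under the hypotheses (i)–(iv) on $L,R$, this problem has a unique solution for every $S\in D[0,\infty)$. *)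

(* Defs.v *)
From HB Require Import structures.
From mathcomp Require Import all_boot all_order all_algebra.
From mathcomp Require Import all_classical all_reals all_analysis.

Set Implicit Arguments.
Unset Strict Implicit.
Unset Printing Implicit Defensive.

Import Order.TTheory GRing.Theory Num.Theory.
Import numFieldNormedType.Exports.

Local Open Scope classical_set_scope.
Local Open Scope ring_scope.

(* A path on [0, oo) is represented by a function on R whose values at negative
   times are irrelevant, unless stated otherwise. *)

Definition cadlag (R : realType) (f : R -> R) : Prop :=
  (forall t : R, 0 <= t -> f s @[s --> t^'+] --> f t) /\
  (forall t : R, 0 < t -> exists l : R, f s @[s --> t^'-] --> l).

Definition nondecreasing_cadlag (R : realType) (f : R -> R) : Prop :=
  cadlag f /\ (forall s t : R, 0 <= s -> s <= t -> f s <= f t).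

Definition bv_cadlag (R : realType) (f : R -> R) : Prop :=
  cadlag f /\ (forall T : R, 0 <= T -> bounded_variation 0 T f).

(* [sp_solution L U S X K Kr Kl]: (X, K) solves the Skorokhod problem for S with
   barriers L and U (written R on paper), with decomposition K = Kr - Kl.
   The condition that a path vanishes at 0- is encoded by extending it by 0 to
   negative times.  Kr and Kl are then nondecreasing and right-continuous on the
   whole line, and their Lebesgue-Stieltjes measures have atoms of mass Kr 0 and
   Kl 0 at time 0, as required. *)
Record sp_solution (R : realType) (L U : R -> R -> R) (S X K : R -> R)
    (Kr Kl : cumulative R R) : Prop := SPSolution {
  sp_cadlagX : cadlag X;
  sp_bvK : bv_cadlag K;
  sp_eq : forall t : R, 0 <= t -> X t = S t + K t;
  sp_barrier : forall t : R, 0 <= t -> L t (X t) <= 0 <= U t (X t);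
  sp_K0 : forall t : R, t < 0 -> K t = 0;
  sp_Kr0 : forall t : R, t < 0 -> Kr t = 0;
  sp_Kl0 : forall t : R, t < 0 -> Kl t = 0;
  sp_decomp : forall t : R, 0 <= t -> K t = Kr t - Kl t;
  sp_intl : (\int[lebesgue_stieltjes_measure Kl]_(s in `[0%R, +oo[)
               (\1_[set s | (L s (X s) < 0)%R] s)%:E = 0)%E;
  sp_intr : (\int[lebesgue_stieltjes_measure Kr]_(s in `[0%R, +oo[)
               (\1_[set s | (U s (X s) > 0)%R] s)%:E = 0)%E
}.

(* Main.v *)
(* Put f = K2r - K1r - nu - (c1-c2)^+ and k = K2l - K1l - (c2-c1)^+, so that
   X1 - X2 = k - f.  When K2r grows, X2 sits on its upper barrier, hence
   X2 >= X1 and f <= k; when K2l grows, likewise k <= f.  Let a be the infimum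
   of the times at which f > 0 or k > 0.  Since L < U and t |-> L(t, X2_t),
   U(t, X2_t) are right-continuous, one of K2r, K2l, say K2l, does not grow on
   some [a, a + e[, so k stays <= 0 there; then f cannot become positive, as K2r
   does not grow while f > 0 >= k.  Hence f, k <= 0 everywhere, and exchanging
   the roles of the two solutions gives the other two inequalities. *)

Require Import Defs.
From HB Require Import structures.
From mathcomp Require Import all_boot all_order all_algebra.
From mathcomp Require Import all_classical all_reals all_analysis.
From mathcomp Require Import lra.

Set Implicit Arguments.
Unset Strict Implicit.
Unset Printing Implicit Defensive.

Import Order.TTheory GRing.Theory Num.Theory.
Import numFieldNormedType.Exports.

Local Open Scope classical_set_scope.
Local Open Scope ring_scope.

Import HBNNSimple.

(* [A] need not be measurable: the integral is a supremum over simple functions. *)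
Lemma integral_indic_eq0_measure0 d (T : measurableType d) (R : realType)
    (mu : {measure set T -> \bar R}) (D A N : set T) :
  measurable N -> N `<=` D -> N `<=` A ->
  (\int[mu]_(x in D) (\1_A x)%:E = 0)%E -> mu N = 0%E.
Proof.
move=> mN ND NA int0; apply/eqP; rewrite eq_le measure_ge0 andbT -int0.
rewrite ge0_integralE; last by move=> x _; rewrite lee_fin.
apply: ereal_sup_ubound; exists (indic_nnsfun R mN).
  move=> x; have -> : indic_nnsfun R mN x = \1_N x by [].
  rewrite indicE; have [xN|xN] := boolP (x \in N); last first.
    by apply: erestrict_ge0 => y _; rewrite lee_fin.
  rewrite inE in xN.
  by rewrite patchE (mem_set (ND _ xN)) indicE (mem_set (NA _ xN)).
by rewrite sintegral_indic.
Qed.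

(** * Null intervals of Lebesgue-Stieltjes measures *)

Section stieltjes.
Context (R : realType).
Implicit Types (f : cumulative R R) (r t : R).

Lemma lebesgue_stieltjes_measure_itvoc f r t : r <= t ->
  lebesgue_stieltjes_measure f `]r, t]%classic = (f t - f r)%:E.
Proof.
move=> rt; rewrite /lebesgue_stieltjes_measure /measure_extension/=.
by rewrite measurable_mu_extE/= ?wlength_itv_bnd//; exact: is_ocitv.
Qed.

(** The closed interval is the decreasing intersection of the intervals from [r - 1/(n+1)] to [t],
    open on the left and of finite mass, so continuity from above makes the increments of [f] over
    them tend to 0. *)
Lemma lebesgue_stieltjes_measure_itvcc0 f r t : r <= t ->
  lebesgue_stieltjes_measure f `[r, t]%classic = 0%E ->
  forall e, 0 < e -> exists2 r', r' < r & f t - f r' < e.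
Proof.
move=> rt mu0 e e0; apply: contrapT => nex.
have ge r' : r' < r -> e <= f t - f r'.
  by move=> r'r; rewrite leNgt; apply/negP => lt; apply: nex; exists r'.
pose F n : set R := `]r - n.+1%:R^-1, t]%classic.
have FE : \bigcap_n F n = `[r, t]%classic.
  apply/seteqP; split => [x Fx|x /=]; last first.
    rewrite in_itv/= => /andP[rx xt] n _; rewrite /F/= in_itv/= xt andbT.
    by rewrite (lt_le_trans _ rx)// ltrBlDr ltrDl invr_gt0.
  have {}Fx n : r - n.+1%:R^-1 < x <= t.
    by have : x \in `]r - n.+1%:R^-1, t] := Fx n I; rewrite in_itv.
  rewrite /= in_itv/=; apply/andP; split; last by have /andP[] := Fx 0%N.
  apply/ler_addgt0Pl => d d0.
  have [n nd] : exists n, n.+1%:R^-1 < d.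
    exists (Num.truncn d^-1); rewrite -[ltRHS]invrK ltf_pV2 ?posrE ?invr_gt0//.
    exact: truncnS_gt.
  have /andP[+ _] := Fx n; move: nd; set z := _^-1 => zd rx; lra.
have lt n : r - n.+1%:R^-1 < r by rewrite ltrBlDr ltrDl invr_gt0.
have muF n : lebesgue_stieltjes_measure f (F n) = (f t - f (r - n.+1%:R^-1))%:E.
  by rewrite lebesgue_stieltjes_measure_itvoc// (le_trans (ltW (lt n))).
have : (lebesgue_stieltjes_measure f \o F) n @[n --> \oo]
    --> lebesgue_stieltjes_measure f (\bigcap_n F n).
  apply: nonincreasing_cvg_mu.
  - by rewrite [ltLHS]muF ltry.
  - by move=> i; exact: measurable_itv.
  - by rewrite FE; exact: measurable_itv.
  - move=> n m nm; apply/subsetPset => x; rewrite /F/= !in_itv/= => /andP[+ ->].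
    rewrite andbT; apply: le_lt_trans; rewrite lerD2l lerN2.
    by rewrite lef_pV2 ?posrE// ler_nat.
rewrite FE mu0 => cv.
have : (e%:E <= 0)%E.
  rewrite -(cvg_lim _ cv)//; apply: lime_ge; first by apply/cvg_ex; exists 0%E.
  by apply: nearW => n /=; rewrite muF lee_fin; exact: ge.
by rewrite lee_fin leNgt e0.
Qed.

(* The nondecreasing function [f] grows only at times in [A]; the second
   condition says that this includes the jump at the left endpoint [r]. *)
Definition grows_on (f : R -> R) (A : set R) :=
  (forall r t, r <= t -> (forall u, r < u -> u <= t -> ~ A u) -> f t = f r) /\
  (forall r t, r <= t -> (forall u, r <= u -> u <= t -> ~ A u) ->
     forall e, 0 < e -> exists2 r', r' < r & f t - f r' < e).

(** An interval that avoids the growth set meets the half-line of nonnegative times only inside [B],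
    where the vanishing integral leaves no mass. *)
Lemma grows_on_lebesgue_stieltjes f (B : set R) :
  (forall t, t < 0 -> f t = 0) ->
  (\int[lebesgue_stieltjes_measure f]_(s in `[0%R, +oo[) (\1_B s)%:E = 0)%E ->
  grows_on f [set t | 0 <= t /\ ~ B t].
Proof.
move=> f0 int0.
have cc r t : r <= t -> (forall u, r <= u -> u <= t -> ~ (0 <= u /\ ~ B u)) ->
     forall e, 0 < e -> exists2 r', r' < r & f t - f r' < e.
  move=> rt nB e e0.
  have [t0|t0] := ltP t 0.
    exists (r - 1); first by lra.
    by rewrite !f0 ?subrr//; lra.
  have mt : Num.max r 0 <= t by rewrite ge_max rt.
  have mu0 : lebesgue_stieltjes_measure f `[Num.max r 0, t]%classic = 0%E.
    apply: integral_indic_eq0_measure0 int0.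
    - exact: measurable_itv.
    - by move=> x /=; rewrite !in_itv/= ge_max andbT => /andP[/andP[]].
    - move=> x /=; rewrite in_itv/= ge_max => /andP[/andP[rx x0] xt].
      by apply: contrapT => ?; exact: (nB x).
  have [r' r'r fr'] := lebesgue_stieltjes_measure_itvcc0 mt mu0 e0.
  have [r0|r0] := ltP r 0; last by exists r' => //; move: r'r; rewrite max_l.
  exists (r - 1); first by lra.
  move: r'r fr'; rewrite max_r ?ltW// => r'0; rewrite (f0 r')// (f0 (r - 1))//.
  by lra.
split=> // r t rt nB.
have [t0|t0] := ltP t 0; first by rewrite !f0// (le_lt_trans rt).
(* If [r < 0], the interval contains time 0 and hence the atom there, so the closed-interval
   statement [cc] is applied from 0. *)
have [r0|r0] := ltP r 0.
  rewrite (f0 r)//; apply/eqP; rewrite eq_le; apply/andP; split.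
    apply/ler_addgt0Pl => e e0; rewrite addr0.
    have [|r' r'0] := @cc 0 t t0 _ _ e0.
      by move=> u u0; apply: nB; lra.
    by rewrite (f0 r')// subr0 => /ltW.
  by rewrite -(f0 r r0); exact: cumulative_is_nondecreasing.
suff : (f t - f r)%:E = 0%E by case=> /eqP; rewrite subr_eq0 => /eqP.
rewrite -lebesgue_stieltjes_measure_itvoc//.
apply: integral_indic_eq0_measure0 int0.
- exact: measurable_itv.
- by move=> x /=; rewrite !in_itv/= andbT => /andP[/ltW rx _]; lra.
- move=> x /=; rewrite in_itv/= => /andP[rx xt]; apply: contrapT => ?.
  by apply: (nB x rx xt); split => //; lra.
Qed.

(** * Comparison of nondecreasing functions through their times of growth *)

Lemma grows_on_le_step (p q w : R -> R) (A : set R) (a t : R) :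
  {homo p : x y / x <= y} -> {homo q : x y / x <= y} -> grows_on p A ->
  (forall s, A s -> p s - q s <= w s) ->
  (forall s, s < a -> p s <= q s) -> (forall s, a <= s <= t -> w s <= 0) ->
  a <= t -> p t <= q t.
Proof.
move=> hp hq [pA1 pA2] Aw lta w0 at_; rewrite leNgt; apply/negP => pqt.
(* Past the supremum [b] of [E], [p] exceeds [q] while [w <= 0], so no time of [A] occurs and [p]
   stays constant; [b] itself may or may not belong to [E]. *)
pose E := [set s | s <= t /\ p s <= q s].
have Esup : has_sup E.
  split; first by exists (a - 1); split; [lra|apply: lta; lra].
  by exists t => s [].
set b := sup E.
have bt : b <= t by apply: ge_sup; [exact: Esup.1|move=> s []].
have ab : a <= b.
  rewrite leNgt; apply/negP => ba.
  have : E ((a + b) / 2) by split; [lra|apply: lta; lra].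
  move=> /(ub_le_sup Esup.2); rewrite -/b; lra.
have gtb s : b < s -> s <= t -> q s < p s.
  move=> bs st; rewrite ltNge; apply/negP => pq.
  have : E s by [].
  move=> /(ub_le_sup Esup.2); rewrite -/b; lra.
have nA s : a <= s <= t -> q s < p s -> ~ A s.
  by move=> ast pq /Aw; have := w0 _ ast; lra.
have [pqb|pqb] := leP (p b) (q b).
  have -/(_ bt) := pA1 b t => ptb.
  have : p t = p b by apply: ptb => u bu ut; apply: nA; [lra|exact: gtb].
  have := hq _ _ bt; lra.
(* Now [b] is not in [A] either, so [p] does not jump there. The tolerance [p t - q t] gives
   [q t < p r'], which a point [s] of [E] beyond [r'] contradicts: [p r' <= p s <= q s <= q t]. *)
have [||r' r'b pr'] := pA2 b t bt _ (p t - q t) _.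
- move=> u; rewrite le_eqVlt => /orP[/eqP<- _|bu ut]; first by apply: nA; lra.
  by apply: nA; [lra|exact: gtb].
- lra.
have [s Es r's] : exists2 s, E s & r' < s.
  have br' : 0 < b - r' by lra.
  have [s Es bs] := sup_adherent br' Esup.
  by exists s => //; move: bs; rewrite -/b; lra.
have [st pqs] := Es.
have := hp _ _ (ltW r's); have := hq _ _ st; lra.
Qed.

Lemma grows_on_le_pair (p q v w : R -> R) (A B : set R) :
  {homo p : x y / x <= y} -> {homo q : x y / x <= y} ->
  {homo v : x y / x <= y} -> {homo w : x y / x <= y} ->
  grows_on p A -> grows_on v B ->
  (forall t, A t -> p t - q t <= v t - w t) ->
  (forall t, B t -> v t - w t <= p t - q t) ->
  (forall t, t < 0 -> p t <= q t /\ v t <= w t) ->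
  (forall t, 0 <= t -> exists2 e, 0 < e &
     (forall u, t <= u < t + e -> ~ A u) \/
     (forall u, t <= u < t + e -> ~ B u)) ->
  forall t, p t <= q t /\ v t <= w t.
Proof.
move=> hp hq hv hw pA vB Apv Bvp neg sep t; apply: contrapT => nt.
pose E := [set s | ~ (p s <= q s /\ v s <= w s)].
have Einf : has_inf E.
  split; first by exists t.
  by exists 0 => s Es; rewrite leNgt; apply/negP => /neg.
set a := inf E.
have lta s : s < a -> p s <= q s /\ v s <= w s.
  move=> sa; apply: contrapT => Es.
  have : E s by [].
  by move=> /(ge_inf Einf.2); rewrite -/a; lra.
have a0 : 0 <= a.
  by apply: lb_le_inf; [exact: Einf.1|move=> s Es; rewrite leNgt; apply/negP => /neg].
(* Absence of growth from [a] on, [a] included, puts [f u] within any [d] of some [f r] with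
   [r < a], and [f r <= g r <= g u]. *)
have quiet (f g : R -> R) (C : set R) e : {homo g : x y / x <= y} ->
    grows_on f C -> (forall s, s < a -> f s <= g s) ->
    (forall u, a <= u < a + e -> ~ C u) ->
    forall u, a <= u < a + e -> f u - g u <= 0.
  move=> hg [_ fC] fg nC u /andP[au ue]; apply/ler_addgt0Pl => d d0.
  have [|r ra fr] := fC a u au _ _ d0.
    by move=> x ax xu; apply: nC; lra.
  have := fg _ ra. have := hg r u. lra.
have [e e0 sepa] := sep a a0.
(* The infimum [a] need not belong to [E], but [E] has points in every interval to the right of [a],
   starting at [a]. *)
suff good u : a <= u < a + e -> p u <= q u /\ v u <= w u.
  have [s Es sae] := inf_adherent e0 Einf.
  have as_ : a <= s by apply: ge_inf Einf.2 _ Es.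
  by apply: Es; apply: good; rewrite as_.
move=> aue; have /andP[au ue] := aue; case: sepa => nC.
- have pq := quiet _ _ _ _ hq pA (fun s h => (lta s h).1) nC.
  split; first by have := pq _ aue; lra.
  apply: (grows_on_le_step hv hw vB Bvp) au; first by move=> s /lta[].
  by move=> s asu; apply: pq; lra.
- have vw := quiet _ _ _ _ hw vB (fun s h => (lta s h).2) nC.
  split; last by have := vw _ aue; lra.
  apply: (grows_on_le_step hp hq pA Apv) au; first by move=> s /lta[].
  by move=> s asu; apply: vw; lra.
Qed.

(** * Right-continuity of the barriers along a path, and comparison of two solutions *)

Lemma at_right_itv (P : set R) (t : R) : P t -> (\forall u \near t^'+, P u) ->
  exists2 e, 0 < e & forall u, t <= u < t + e -> P u.
Proof.
move=> Pt; rewrite /at_right -nbhs_nearE -filter_from_ballE => -[e /= e0 eP].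
exists e => // u /andP[]; rewrite le_eqVlt => /orP[/eqP<-//|tu ut].
by apply: eP => //=; rewrite /ball/= distrC ger0_norm; lra.
Qed.

Lemma cvg_at_right_lipschitz (F : R -> R -> R) (X : R -> R) (C t : R) : 0 <= t ->
  (forall u x y, 0 <= u -> `|F u x - F u y| <= C * `|x - y|) ->
  X u @[u --> t^'+] --> X t ->
  F u (X t) @[u --> t^'+] --> F t (X t) ->
  F u (X u) @[u --> t^'+] --> F t (X t).
Proof.
move=> t0 lipF cX cF; apply/cvgrPdist_lt => e e0.
(* No sign is assumed on [C], so the division is by this positive bound instead. *)
have C0 : 0 < `|C| + 1 by rewrite ltr_wpDl.
have e2 : 0 < e / 2 by lra.
have eC : 0 < e / 2 / (`|C| + 1) by rewrite divr_gt0.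
move/cvgrPdist_lt : cX => /(_ _ eC) cX; move/cvgrPdist_lt : cF => /(_ _ e2) cF.
near=> u.
have tu : t < u by near: u; exact: nbhs_right_gt.
have Fu : `|F t (X t) - F u (X t)| < e / 2 by near: u.
have Xu : `|X t - X u| < e / 2 / (`|C| + 1) by near: u.
have u0 : 0 <= u by lra.
rewrite -(subrKA (F u (X t))) (le_lt_trans (ler_normD _ _))//.
suff : `|F u (X t) - F u (X u)| <= e / 2 by lra.
apply: (le_trans (lipF _ _ _ u0)).
have := ler_norm C; have := normr_ge0 (X t - X u).
move: Xu; rewrite ltr_pdivlMr//; nra.
Unshelve. all: by end_near. Qed.

(** [Y] stands for the other solution, and [q], [w] for its two regulators shifted by constants and
    [nu]. When [Kr] grows, [U t (X t) <= 0 <= U t (Y t)] forces [X t <= Y t]; when [Kl] grows,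
    [L t (Y t) <= 0 <= L t (X t)] forces [Y t <= X t]. *)
Lemma sp_solution_le (L U : R -> R -> R) (C : R)
    (S X K : R -> R) (Kr Kl : cumulative R R) (Y q w : R -> R) :
  (forall x, cadlag (L^~ x) /\ cadlag (U^~ x)) ->
  (forall t, 0 <= t -> {homo L t : x y / x < y} /\ {homo U t : x y / x < y}) ->
  (forall t x y, 0 <= t -> `|L t x - L t y| <= C * `|x - y| /\
                         `|U t x - U t y| <= C * `|x - y|) ->
  (forall t x, 0 <= t -> L t x < U t x) ->
  sp_solution L U S X K Kr Kl ->
  {homo q : x y / x <= y} -> {homo w : x y / x <= y} ->
  (forall t, t < 0 -> 0 <= q t /\ 0 <= w t) ->
  (forall t, 0 <= t -> L t (Y t) <= 0 <= U t (Y t)) ->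
  (forall t, 0 <= t -> Y t - X t = (Kl t - w t) - (Kr t - q t)) ->
  forall t, Kr t <= q t /\ Kl t <= w t.
Proof.
move=> cadLU monoLU lipLU ltLU [cadX _ _ _ _ Kr0 Kl0 _ intl intr].
move=> hq hw qw0 barY YX.
apply: (grows_on_le_pair _ hq _ hw (grows_on_lebesgue_stieltjes Kr0 intr)
  (grows_on_lebesgue_stieltjes Kl0 intl)).
- by move=> x y; exact: cumulative_is_nondecreasing.
- by move=> x y; exact: cumulative_is_nondecreasing.
- move=> t [t0 /= UX]; rewrite -subr_ge0 -YX// subr_ge0 leNgt.
  apply/negP => /(monoLU t t0).2 UYX; apply: UX.
  by have /andP[_ +] := barY t t0; move/le_lt_trans; apply.
- move=> t [t0 /= LX]; rewrite -subr_le0 -YX// subr_le0 leNgt.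
  apply/negP => /(monoLU t t0).1 LXY; apply: LX.
  by have /andP[+ _] := barY t t0; exact: lt_le_trans.
- by move=> t t0; rewrite Kr0// Kl0//; exact: qw0.
move=> t t0.
(* A negative [L] stays negative for a while, which stops [Kl]. Otherwise [U] exceeds [L >= 0] and
   stays positive for a while, which stops [Kr]. *)
have [L0|L0] := ltP (L t (X t)) 0.
- have cL : L u (X u) @[u --> t^'+] --> L t (X t).
    apply: (cvg_at_right_lipschitz t0) (cadX.1 t t0) _.
      by move=> u x y /(lipLU u x y)[lu _]; exact: lu.
    exact: (cadLU (X t)).1.1.
  have [//|e e0 eL] := @at_right_itv (fun u => L u (X u) < 0) t L0.
    exact: cvgr_lt L0.
  by exists e => //; right => u /eL Lu [_]; apply.
- have U0 := le_lt_trans L0 (ltLU _ _ t0).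
  have cU : U u (X u) @[u --> t^'+] --> U t (X t).
    apply: (cvg_at_right_lipschitz t0) (cadX.1 t t0) _.
      by move=> u x y /(lipLU u x y)[_ lu]; exact: lu.
    exact: (cadLU (X t)).2.1.
  have [//|e e0 eU] := @at_right_itv (fun u => 0 < U u (X u)) t U0.
    exact: cvgr_gt U0.
  by exists e => //; left => u /eU Uu [_]; apply.
Qed.

End stieltjes.

Theorem theorem3p6 (R : realType) (L U : R -> R -> R)
    (hD : forall x, cadlag (fun t => L t x) /\ cadlag (fun t => U t x))
    (hmono : forall t : R, 0 <= t ->
       {homo L t : x y / x < y} /\ {homo U t : x y / x < y})
    (hlip : exists c C : R, [/\ 0 < c, c < C &
       forall t x y : R, 0 <= t ->
         c * `|x - y| <= `|L t x - L t y| <= C * `|x - y| /\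
         c * `|x - y| <= `|U t x - U t y| <= C * `|x - y|])
    (hinf : (0 < ereal_inf [set (U p.1 p.2 - L p.1 p.2)%:E |
                              p in [set p : R * R | (0 <= p.1)%R]])%E)
    (c1 c2 : R) (S1 S2 : R -> R)
    (hS1 : cadlag S1) (hS2 : cadlag S2) (hS10 : S1 0 = 0) (hS20 : S2 0 = 0)
    (nu : R -> R) (hnu : nondecreasing_cadlag nu)
    (hS : forall t : R, 0 <= t -> S1 t = S2 t + nu t)
    (X1 K1 X2 K2 : R -> R) (K1r K1l K2r K2l : cumulative R R)
    (hsol1 : sp_solution L U (fun t => c1 + S1 t) X1 K1 K1r K1l)
    (hsol2 : sp_solution L U (fun t => c2 + S2 t) X2 K2 K2r K2l) :
  forall t : R, 0 <= t ->
    (K1r t - Num.max (c2 - c1) 0 <= K2r t <=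
       K1r t + nu t + Num.max (c1 - c2) 0) /\
    (K2l t - Num.max (c2 - c1) 0 <= K1l t <=
       K2l t + nu t + Num.max (c1 - c2) 0).
Proof.
have [c [C [_ _ lip]]] := hlip.
have lipLU t x y : 0 <= t -> `|L t x - L t y| <= C * `|x - y| /\
    `|U t x - U t y| <= C * `|x - y|.
  by move=> /(lip t x y)[/andP[_ ?] /andP[_ ?]].
have ltLU t x : 0 <= t -> L t x < U t x.
  move=> t0; rewrite -subr_gt0 -lte_fin (lt_le_trans hinf)//.
  by apply: ereal_inf_lbound; exists (t, x).
have nu00 : nu 0 = 0 by have := hS 0 (lexx 0); lra.
(* Extending [nu] by [0] to negative times makes it monotone on the whole line. *)
pose nu0 t := nu (Num.max t 0).
have nu0E t : 0 <= t -> nu0 t = nu t by move=> t0; rewrite /nu0 max_l.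
have hnu0 : {homo nu0 : x y / x <= y}.
  by move=> x y xy; apply: hnu.2; [rewrite le_max lexx orbT|exact: le_max2].
have nu0N t : t < 0 -> nu0 t = 0 by move=> t0; rewrite /nu0 max_r// ltW.
set a := Num.max (c1 - c2) 0; set b := Num.max (c2 - c1) 0.
have a0 : 0 <= a by rewrite le_max lexx orbT.
have b0 : 0 <= b by rewrite le_max lexx orbT.
(* Splitting the initial gap into positive and negative parts lets each regulator absorb one
   nonnegative constant. *)
have ab : c1 - c2 = a - b.
  rewrite /a /b; have [c12|c21] := leP c1 c2.
    by rewrite max_r ?max_l ?subr_ge0 ?subr_le0//; lra.
  by rewrite max_l ?max_r ?subr_ge0 ?subr_le0 ?ltW//; lra.
have hX t : 0 <= t -> X1 t - X2 t =
    a - b + nu t + (K1r t - K1l t) - (K2r t - K2l t).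
  move=> t0; rewrite (sp_eq hsol1)// (sp_eq hsol2)// (sp_decomp hsol1)//.
  by rewrite (sp_decomp hsol2)// (hS t t0); lra.
have nd (f : cumulative R R) : {homo f : x y / x <= y}.
  by move=> x y; exact: cumulative_is_nondecreasing.
have le2 : forall t, K2r t <= K1r t + nu0 t + a /\ K2l t <= K1l t + b.
  apply: (sp_solution_le hD hmono lipLU ltLU hsol2 _ _ _ (sp_barrier hsol1)).
  - by move=> x y xy; have := nd K1r _ _ xy; have := hnu0 _ _ xy; lra.
  - by move=> x y xy; have := nd K1l _ _ xy; lra.
  - by move=> t t0; rewrite (sp_Kr0 hsol1)// (sp_Kl0 hsol1)// nu0N//; lra.
  - by move=> t t0; rewrite hX// nu0E//; lra.
(* The exchange reverses the sign of [X1 - X2], so [nu0] and [a] pass to the bound for [Kl], and [b]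
   to the one for [Kr]. *)
have le1 : forall t, K1r t <= K2r t + b /\ K1l t <= K2l t + nu0 t + a.
  apply: (sp_solution_le hD hmono lipLU ltLU hsol1 _ _ _ (sp_barrier hsol2)).
  - by move=> x y xy; have := nd K2r _ _ xy; lra.
  - by move=> x y xy; have := nd K2l _ _ xy; have := hnu0 _ _ xy; lra.
  - by move=> t t0; rewrite (sp_Kr0 hsol2)// (sp_Kl0 hsol2)// nu0N//; lra.
  - by move=> t t0; rewrite -opprB hX// nu0E//; lra.
by move=> t t0; have := le1 t; have := le2 t; rewrite nu0E//; lra.
Qed.
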